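(* Let $T>0$, let $f\colon[0,+\infty)\to\mathbb{R}$ be a bounded continuous $T$-periodic function that is absolutely continuous (on every compact interval), and let $\alpha\in(0,1)$. If the Caputo fractional derivative ${}^{C}D^\alpha f$ is a bounded function, then it is an S-asymptotically $T$-periodic function.
   Context: Write $\mathbb{R}^+=[0,+\infty)$. For $\beta>0$, the fractional integral of order $\beta$ is $I^\beta h(t)=\dfrac{1}{\Gamma(\beta)}\displaystyle\int_0^t (t-s)^{\beta-1}h(s)\,ds$, $t>0$. For $\alpha\in(0,1)$ and $f$ absolutely continuous on every compact interval, the Caputo fractional derivative is ${}^{C}D^\alpha f(t)=I^{1-\alpha}f'(t)=\dfrac{1}{\Gamma(1-\alpha)}\displaystyle\int_0^t (t-s)^{-\alpha}f'(s)\,ds$. A function $\varphi$ in the space $\mathcal{C}_b(\mathbb{R}^+,\mathbb{R})$ of bounded continuous functions on $\mathbb{R}^+$ is S-asymptotically $T$-periodic if $\lim_{t\to+\infty}[\varphi(t+T)-\varphi(t)]=0$.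
   Formalization: A bounded Caputo derivative need not be continuous, so membership in C_b can fail; the limit of the T-differences is proved always, and S-asymptotic T-periodicity (with C_b) is proved when the derivative is, or extends to, a continuous function on [0,+∞). *)

(* Defs.v *)
(* MathComp-Analysis, over an arbitrary [R : realType].  A function on
   R^+ = [0, +oo[ is a total function [R -> R] about which only the values on
   `[0, +oo[ are ever used. *)
From HB Require Import structures.
From mathcomp Require Import all_boot all_order all_algebra.
From mathcomp Require Import all_classical all_reals all_analysis.

Set Implicit Arguments.
Unset Strict Implicit.
Unset Printing Implicit Defensive.

Import Order.TTheory GRing.Theory Num.Theory.
Import numFieldNormedType.Exports.

Local Open Scope classical_set_scope.
Local Open Scope ring_scope.

Section Defs.
Context {R : realType}.
Implicit Types (f h phi : R -> R) (a b t T alpha beta : R).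

Definition Gamma b : R :=
  \int[lebesgue_measure]_(x in `]0, +oo[) (x `^ (b - 1) * expR (- x)).

(* Lebesgue integral; the endpoints, where the kernel may be singular and where
   the two-sided derivative of a function on R^+ is meaningless, are left out.
   [Rintegral] is total: its value is 0 where the integral does not
   converge absolutely. *)
Definition frac_integral beta h t : R :=
  (Gamma beta)^-1 *
  \int[lebesgue_measure]_(s in `]0, t[) ((t - s) `^ (beta - 1) * h s).

(* For an absolutely continuous [f], [derive1 f] is the derivative at almost every
   s > 0; its default value elsewhere is irrelevant to the integral. *)
Definition caputo alpha f : R -> R := frac_integral (1 - alpha) (derive1 f).

Definition abs_continuous a b f : Prop :=
  forall e, 0 < e -> exists2 d, 0 < d &
    forall (n : nat) (u v : 'I_n -> R),
      (forall i, a <= u i /\ u i <= v i /\ v i <= b) ->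
      trivIset [set: 'I_n] (fun i => `]u i, v i[%classic) ->
      \sum_(i < n) (v i - u i) < d ->
      \sum_(i < n) `|f (v i) - f (u i)| < e.

Definition bounded_continuous : set (R -> R) :=
  [set phi : R -> R | {within `[0, +oo[, continuous phi} /\
             [bounded phi t | t in `[0, +oo[]].

(* [trigo.periodic] quantifies over the whole line. *)
Definition periodic_nneg T f : Prop := forall t, 0 <= t -> f (t + T) = f t.

Definition S_asymptotically_periodic T phi : Prop :=
  bounded_continuous phi /\ phi (t + T) - phi t @[t --> +oo] --> (0 : R).

End Defs.

(* Main.v *)
Require Import Defs.
From HB Require Import structures.
From mathcomp Require Import all_boot all_order all_algebra.
From mathcomp Require Import all_classical all_reals all_analysis.
From mathcomp Require Import measurable_realfun lra.
Import Order.TTheory GRing.Theory Num.Theory.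
Import numFieldNormedType.Exports.
Local Open Scope classical_set_scope.
Local Open Scope ring_scope.

(** Write [g] for [derive1 f] and [a] for [alpha].  Since [f] is [T]-periodic,
    so is [g] on ]0, +oo[, and translating the variable by [T] identifies the
    part over ]T, t + T[ of the integral defining the Caputo derivative at
    [t + T] with the whole integral at [t].  The difference of the two
    derivatives is therefore a constant times
      [\int_(s in `]0, T]) (t + T - s) `^ (- a) * g s],
    which is bounded by [t `^ (- a) * \int_(s in `]0, T]) `|g s|] and tends
    to 0 ([frac_kernel_shift], [caputo_shift_cvg]).

    At some [t] the integral defining the Caputo derivative may diverge, and its
    conventional value is then 0.  The splitting above holds for extended-real
    integrals, its first part being finite; hence divergence at [t] forces
    divergence at [t + T], and the difference is 0 ([fineB_le]).

    It remains to know that [g] is integrable on ]0, T].  It is Borel because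
    the set where the difference quotients converge is a countable intersection
    of countable unions of closed sets, and [g] is 0 off that set
    ([measurable_derive1]).  By Fatou's lemma, the integral of [`|g|] is
    controlled by the integrals of [`|f (x + h) - f x| / h] for small [h].
    Over a short interval, such an integral is an average of variations of [f]
    along progressions of difference [h], which absolute continuity bounds
    ([integral_slope_le1], [integrable_derive1]). *)

(** * Translation of Lebesgue integrals *)

Section Shift.
Set Implicit Arguments.
Unset Strict Implicit.
Context {R : realType}.
Local Notation mu := (@lebesgue_measure R).

Lemma preimage_shift_itv (a : R) (b1 b2 : bool) (x y : R) :
  (fun z : R => z + a) @^-1` [set` Interval (BSide b1 x) (BSide b2 y)] =
  [set` Interval (BSide b1 (x - a)) (BSide b2 (y - a))].
Proof.
apply/seteqP; split=> z /=; rewrite !in_itv /=;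
  by case: b1; case: b2; rewrite /= ?lerBlDr ?ltrBlDr ?lerBrDr ?ltrBrDr.
Qed.

Lemma measurable_shift (a : R) :
  measurable_fun [set: measurableTypeR R]
    ((fun z : R => z + a) : measurableTypeR R -> measurableTypeR R).
Proof. exact: measurable_funD. Qed.

Lemma ge0_integral_shift (a : R) (D : set (measurableTypeR R))
    (f : R -> \bar R) :
  measurable D -> measurable_fun D f -> (forall x, D x -> (0 <= f x)%E) ->
  (\int[mu]_(x in D) f x =
   \int[mu]_(x in (fun z : R => (z + a)%R) @^-1` D) f (x + a)%R)%E.
Proof.
move=> mD mf f0.
pose shift_mfun := HB.pack
  (fun z : measurableTypeR R => z + a : measurableTypeR R)
  (isMeasurableFun.Build _ _ _ _ _ (measurable_shift a)) : {mfun _ >-> _}.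
rewrite -(ge0_integral_pushforward (measurable_shift a) mu)//; last first.
  by move=> x; rewrite inE; exact: f0.
apply: (@eq_measure_integral _ _ _ _ (pushforward mu shift_mfun)) => A mA _.
apply: lebesgue_measure_unique => // _ [[x y] _ <-] /=.
rewrite /pushforward preimage_shift_itv !lebesgue_measure_itv /= !lte_fin.
by rewrite ltrD2r -!EFinB; case: ifP => // _; congr (_%:E); lra.
Qed.

(** The positive and the negative part are translated separately, so the
    identity also covers integrals that are infinite or of the form
    [+oo - +oo]. *)
Lemma integral_shift (a : R) (D : set (measurableTypeR R)) (f : R -> \bar R) :
  measurable D -> measurable_fun D f ->
  (\int[mu]_(x in D) f x =
   \int[mu]_(x in (fun z : R => (z + a)%R) @^-1` D) f (x + a)%R)%E.
Proof.
move=> mD mf; rewrite integralE [RHS]integralE.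
rewrite (funepos_comp f (fun z => z + a)%R) (funeneg_comp f (fun z => z + a)%R).
congr (_ - _)%E.
- by apply: (ge0_integral_shift a mD) => //; exact: measurable_funepos.
- by apply: (ge0_integral_shift a mD) => //; exact: measurable_funeneg.
Qed.

End Shift.

(** * Measurability of the derivative *)

Section Derivative.
Set Implicit Arguments.
Unset Strict Implicit.
Context {R : realType}.
Implicit Types (f : R -> R) (x h : R).

Definition slope f h x : R := h^-1 * (f (h + x) - f x).

(** One instance of the Cauchy criterion for the slopes at [x].  Each condition
    is closed in [x], so the intersection over all pairs of steps, although
    uncountable, is closed too. *)
Definition slope_cauchy f (k m : nat) : set R :=
  \bigcap_(h in [set h : R | 0 < `|h| < m.+1%:R^-1])
  \bigcap_(h' in [set h : R | 0 < `|h| < m.+1%:R^-1])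
     [set x | `|slope f h x - slope f h' x| <= k.+1%:R^-1].

Definition slope_cvg f : set R := \bigcap_k \bigcup_m slope_cauchy f k m.

Lemma continuous_slope f h : continuous f -> continuous (slope f h).
Proof.
move=> cf x; apply: cvgM; first exact: cvg_cst.
apply: cvgB; last exact: cf.
apply: (@continuous_comp _ _ _ (fun z => h + z) f); last exact: cf.
by apply: cvgD; [exact: cvg_cst|exact: cvg_id].
Qed.

Lemma closed_slope_cauchy f k m : continuous f -> closed (slope_cauchy f k m).
Proof.
move=> cf; apply: closed_bigI => h _; apply: closed_bigI => h' _.
have cd : continuous (fun x => `|slope f h x - slope f h' x|).
  by move=> x; apply: cvg_norm; apply: cvgB; exact: continuous_slope.
rewrite [X in closed X](_ : _ =
  (fun x => `|slope f h x - slope f h' x|) @^-1` [set z | z <= k.+1%:R^-1])//.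
by apply: closed_comp => [x _|]; [exact: cd|exact: closed_le].
Qed.

Lemma measurable_slope_cvg f : continuous f ->
  measurable (slope_cvg f : set (measurableTypeR R)).
Proof.
move=> cf; apply: bigcapT_measurable => k; apply: bigcup_measurable => m _.
by apply: closed_measurable; exact: closed_slope_cauchy.
Qed.

Lemma slope_cvgP f x : slope_cvg f x <-> cvg (slope f ^~ x @ (0 : R)^').
Proof.
split=> [sx|/cauchy_cvgP/cauchy_ballP ch k _].
- apply/cauchy_cvgP/cauchy_ballP => e e0.
  have ke : (Num.truncn e^-1).+1%:R^-1 < e.
    by rewrite invf_plt ?posrE// truncnS_gt.
  have [m _ mx] := sx (Num.truncn e^-1) I.
  pose A := [set slope f h x | h in [set h : R | 0 < `|h| < m.+1%:R^-1]].
  have FA : (slope f ^~ x @ (0 : R)^') A.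
    change (\forall h \near (0 : R)^', A (slope f h x)).
    near=> h; exists h => //=; apply/andP; split.
      by rewrite normr_gt0; near: h; exact: nbhs_dnbhs_neq.
    by near: h; apply: dnbhs0_lt; rewrite invr_gt0.
  exists (A, A) => // -[_ _] [/= [h hm <-] [h' hm' <-]].
  by rewrite -ball_normE /=; apply: le_lt_trans ke; exact: mx.
- have k0 : 0 < k.+1%:R^-1 :> R by rewrite invr_gt0.
  have [[A B] [/= FA FB] AB] := ch _ k0.
  have /nbhs_ballP[d /= d0 dAB] : nbhs (0 : R) [set h | h != 0 ->
      A (slope f h x) /\ B (slope f h x)].
    change (\forall h \near (0 : R)^', A (slope f h x) /\ B (slope f h x)).
    exact: (filterI FA FB).
  have md : (Num.truncn d^-1).+1%:R^-1 < d.
    by rewrite invf_plt ?posrE// truncnS_gt.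
  exists (Num.truncn d^-1) => // h /andP[h0 hd] h' /andP[h'0 h'd] /=.
  have dh y : 0 < `|y| < (Num.truncn d^-1).+1%:R^-1 ->
      A (slope f y x) /\ B (slope f y x).
    move=> /andP[y0 yd]; apply: dAB; last by rewrite -normr_gt0.
    by rewrite -ball_normE /= sub0r normrN (lt_trans yd).
  have [Ah _] := dh h ltac:(by rewrite h0).
  have [_ Bh] := dh h' ltac:(by rewrite h'0).
  have := AB (slope f h x, slope f h' x) (conj Ah Bh).
  by rewrite -ball_normE /= => /ltW.
Unshelve. all: by end_near. Qed.

Lemma slope_cvg_to f x (u : R ^nat) : slope_cvg f x ->
  (forall n, u n != 0) -> u @ \oo --> (0 : R) ->
  slope f (u n) x @[n --> \oo] --> derive1 f x.
Proof.
move=> /slope_cvgP cx u0 ucv.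
have : slope f ^~ x @ (0 : R)^' --> derive1 f x by exact: cx.
by move/cvgr_dnbhsP; apply.
Qed.

(** The limit of a divergent family is the default point of [R], which is 0. *)
Lemma derive1_dvg f x : ~ slope_cvg f x -> derive1 f x = 0.
Proof. move=> nx; apply: dvgP => cx; apply: nx; exact/slope_cvgP. Qed.

(** Truncation to the Borel set where the slopes converge turns [derive1 f],
    default values included, into an everywhere pointwise limit. *)
Lemma slope_indic_cvg f x (u : R ^nat) :
  (forall n, u n != 0) -> u @ \oo --> (0 : R) ->
  slope f (u n) x * \1_(slope_cvg f) x @[n --> \oo] --> derive1 f x.
Proof.
move=> u0 ucv; have [xD|xD] := pselect (slope_cvg f x).
  have -> : (fun n => slope f (u n) x * \1_(slope_cvg f) x) =
            (fun n => slope f (u n) x).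
    by apply/funext => n; rewrite indicE mem_set// mulr1.
  exact: slope_cvg_to.
have -> : (fun n => slope f (u n) x * \1_(slope_cvg f) x) = cst 0.
  by apply/funext => n; rewrite indicE memNset// mulr0.
by rewrite (derive1_dvg xD); exact: cvg_cst.
Qed.

Lemma measurable_slope_indic f h : continuous f ->
  measurable_fun [set: measurableTypeR R]
    (fun x => slope f h x * \1_(slope_cvg f) x).
Proof.
move=> cf; apply: measurable_funM.
  by apply: continuous_measurable_fun; exact: continuous_slope.
by apply: measurable_indic; exact: measurable_slope_cvg.
Qed.

Lemma measurable_derive1 f : continuous f ->
  measurable_fun [set: measurableTypeR R] (derive1 f).
Proof.
move=> cf; apply: (@measurable_fun_cvg _ _ _ _
  (fun n x => slope f n.+1%:R^-1 x * \1_(slope_cvg f) x)).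
- by move=> n; exact: measurable_slope_indic.
- by move=> x _; apply: slope_indic_cvg => //; exact: cvg_harmonic.
Qed.

End Derivative.

(** * Integrability of the derivative of an absolutely continuous function *)

Section Integrability.
Set Implicit Arguments.
Unset Strict Implicit.
Context {R : realType}.
Implicit Types (f : R -> R) (x h : R).
Local Notation mu := (@lebesgue_measure R).

(** The instance of [abs_continuous] at tolerance 1, with its modulus exposed:
    [d] is the scale of the windows on which the integral of [`|derive1 f|] is
    at most 1. *)
Definition unit_variation f (a b d : R) : Prop :=
  forall (n : nat) (u v : 'I_n -> R),
    (forall i, a <= u i /\ u i <= v i /\ v i <= b) ->
    trivIset [set: 'I_n] (fun i => `]u i, v i[%classic) ->
    \sum_(i < n) (v i - u i) < d ->
    \sum_(i < n) `|f (v i) - f (u i)| < 1.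

Lemma itv_ocU (a b c : R) : a <= b -> b <= c ->
  `]a, c]%classic = `]a, b] `|` `]b, c].
Proof.
move=> ab bc; apply/seteqP; split=> x /=; rewrite !in_itv /=.
  by case: (leP x b) => xb; move=> /andP[ax xc]; [left|right]; lra.
by case; lra.
Qed.

Lemma disj_itv_oc (a b : R) (B : itv_bound R) :
  [disjoint `]a, b]%classic & [set` Interval (BRight b) B]].
Proof.
apply/disj_setPS => x /=; rewrite !in_itv /= => -[/andP[_ xb] /andP[bx _]].
by move: (lt_le_trans bx xb); rewrite ltxx.
Qed.

(** Cutting an interval into [n] steps of length [h] and translating every step
    back to ]0, h] puts, under a single integral, the values of [u] along an
    arithmetic progression of difference [h]. *)
Lemma ge0_integral_fold (u : R -> \bar R) (c h : R) (n : nat) : 0 <= h ->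
  measurable_fun [set: measurableTypeR R] u -> (forall x, (0 <= u x)%E) ->
  (\int[mu]_(x in `]c, (c + n%:R * h)%R]) u x =
   \int[mu]_(x in `]0%R, h]) \sum_(k < n) u (x + (c + k%:R * h))%R)%E.
Proof.
move=> h0 mu_ u0.
rewrite ge0_integral_sum//; last first.
  move=> k; apply: measurable_funTS.
  exact: (measurableT_comp mu_ (measurable_shift _)).
elim: n => [|n ih].
  by rewrite mul0r addr0 set_itvoc0 integral_set0 big_ord0.
rewrite big_ord_recr /= -ih (@itv_ocU c (c + n%:R * h)); last 2 first.
- by rewrite lerDl mulr_ge0.
- by rewrite lerD2l ler_wpM2r// ler_nat.
rewrite ge0_integral_setU//=; last 2 first.
- exact: measurable_funTS.
- exact: disj_itv_oc.
congr (_ + _)%E.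
rewrite (ge0_integral_shift (c + n%:R * h))//; last exact: measurable_funTS.
rewrite preimage_shift_itv subrr.
by have -> : c + n.+1%:R * h - (c + n%:R * h) = h by rewrite -natr1; lra.
Qed.

Lemma variation_steps f (a b d c h : R) (n : nat) :
  unit_variation f a b d ->
  0 <= h -> n%:R * h < d -> a <= c -> c + n%:R * h <= b ->
  \sum_(k < n) `|f (c + k%:R * h + h) - f (c + k%:R * h)| < 1.
Proof.
move=> acf h0 nhd ac cb.
apply: (acf _ (fun k : 'I_n => c + k%:R * h)
              (fun k : 'I_n => c + k%:R * h + h)).
- move=> i; have i0 : 0 <= i%:R * h by rewrite mulr_ge0.
  have iS : i%:R * h + h <= n%:R * h.
    by rewrite -{2}[h]mul1r -mulrDl natr1 ler_wpM2r// ler_nat.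
  by split; [lra|split; lra].
- move=> i j _ _ [x [/=]]; rewrite !in_itv /= => /andP[ix xi] /andP[jx xj].
  have le_idx (k l : 'I_n) : c + l%:R * h < x -> x < c + k%:R * h + h ->
      (l <= k)%N.
    move=> lx xk; rewrite leqNgt; apply/negP => kl.
    have : k%:R * h + h <= l%:R * h.
      by rewrite -{2}[h]mul1r -mulrDl natr1 ler_wpM2r// ler_nat.
    lra.
  by apply/val_inj/eqP; rewrite eqn_leq !le_idx.
- rewrite (eq_bigr (fun=> h)); last by move=> i _; rewrite addrAC subrr add0r.
  by rewrite sumr_const card_ord -mulr_natl.
Qed.

(** After folding, the integrand at [x] is [h^-1] times the variation of [f]
    along the progression [c + x + k h], hence at most [h^-1], on an interval
    of length [h].  The extra [h] in the last hypothesis makes room for the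
    point [x + h] of the last step. *)
Lemma integral_slope_le1 f (a b d c h : R) (n : nat) :
  continuous f ->
  unit_variation f a b d ->
  0 < h -> n%:R * h < d -> a <= c -> c + n%:R * h + h <= b ->
  (\int[mu]_(x in `]c, (c + n%:R * h)%R]) `|slope f h x|%:E <= 1)%E.
Proof.
move=> cf acf h0 nhd ac cb.
have mslope : measurable_fun [set: measurableTypeR R]
    (fun x => `|slope f h x|%:E).
  apply/measurable_EFinP; apply: (measurableT_comp (@normr_measurable R setT)).
  by apply: continuous_measurable_fun; exact: continuous_slope.
rewrite ge0_integral_fold//; last exact: ltW.
apply: (@le_trans _ _ (\int[mu]_(x in `]0%R, h]) (h^-1)%:E)%E).
  apply: ge0_le_integral => //.
  - by move=> x _; apply: sume_ge0.
  - apply: emeasurable_sum => k; apply: measurable_funTS.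
    exact: (measurableT_comp mslope (measurable_shift _)).
  - move=> x /=; rewrite in_itv /= => /andP[x0 xh].
    rewrite sumEFin lee_fin.
    rewrite (eq_bigr (fun k : 'I_n => h^-1 *
        `|f ((c + x) + k%:R * h + h) - f ((c + x) + k%:R * h)|)); last first.
      move=> k _; rewrite /slope normrM gtr0_norm ?invr_gt0//.
      by congr (_ * `|f _ - f _|); lra.
    rewrite -mulr_sumr ler_piMr ?invr_ge0 ?ltW//.
    by apply: (variation_steps acf) => //; lra.
rewrite integral_cst//= lebesgue_measure_itv/= lte_fin h0 -EFinB subr0 -EFinM.
by rewrite mulVf// gt_eqF.
Qed.

Lemma ge_limn_einf (u : (\bar R)^nat) (m : \bar R) :
  (forall n, (u n <= m)%E) -> (limn_einf u <= m)%E.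
Proof.
move=> um; rewrite limn_einf_lim; apply: lime_le; first exact: is_cvg_einfs.
by apply: nearW => n; apply: ge_ereal_inf; exists (u n) => //; exists n => /=.
Qed.

(** Fatou's lemma, along the steps [e / n.+1], carries the bound on the slopes
    to the derivative.  It is applied to the truncated slopes, which converge
    at every point. *)
Lemma integral_derive1_le1 f (a b d c e : R) :
  continuous f ->
  unit_variation f a b d ->
  0 < e -> e < d -> a <= c -> c + e + e <= b ->
  (\int[mu]_(x in `]c, (c + e)%R]) `|derive1 f x|%:E <= 1)%E.
Proof.
move=> cf acf e0 ed ac cb.
pose h n : R := e / n.+1%:R.
have h0 n : 0 < h n by rewrite divr_gt0.
have nh n : n.+1%:R * h n = e by rewrite mulrC divfK// pnatr_eq0.
have hcv : h @ \oo --> (0 : R).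
  rewrite -[0](mulr0 e); apply: cvgM; [exact: cvg_cst|exact: cvg_harmonic].
pose u n x := `|slope f (h n) x * \1_(slope_cvg f) x|%:E.
have mu_ n : measurable_fun [set: measurableTypeR R] (u n).
  apply/measurable_EFinP; apply: (measurableT_comp (@normr_measurable R setT)).
  exact: measurable_slope_indic.
have -> : (fun x => `|derive1 f x|%:E) = (fun x => limn_einf (u ^~ x)).
  apply/funext => x.
  have : u ^~ x @ \oo --> `|derive1 f x|%:E.
    apply: cvg_EFin; first by near=> n.
    by apply: cvg_norm; apply: slope_indic_cvg => // n; rewrite gt_eqF.
  by move=> /cvg_limn_einf_sup[-> _].
apply: (le_trans (fatou _ _ _ _)) => //.
- by move=> n; exact: measurable_funTS.
- by move=> n x _; rewrite lee_fin.
apply: ge_limn_einf => n.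
have : (\int[mu]_(x in `]c, (c + n.+1%:R * h n)%R]) `|slope f (h n) x|%:E
        <= 1)%E.
  apply: (integral_slope_le1 cf acf) => //; rewrite ?nh//.
  have : h n <= e by rewrite ler_pdivrMr// ler_peMr ?ler1n ?(ltW e0).
  lra.
rewrite nh; apply: le_trans; apply: ge0_le_integral => //.
- by move=> x _; rewrite lee_fin.
- exact: measurable_funTS.
- apply: measurable_funTS; apply/measurable_EFinP.
  apply: (measurableT_comp (@normr_measurable R setT)).
  by apply: continuous_measurable_fun; exact: continuous_slope.
- move=> x _; rewrite lee_fin normrM ler_piMr// indicE.
  by case: (_ \in _); rewrite ?normr1 ?normr0.
Unshelve. all: by end_near. Qed.

(** [N] consecutive windows of length [e], short enough for [unit_variation],
    cover ]a, b], so the integral of [`|derive1 f|] is at most [N].  The margin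
    between [b] and [b'] is room for the slopes taken near [b]. *)
Lemma integrable_derive1 f (a b b' : R) : continuous f ->
  a < b -> b < b' -> abs_continuous a b' f ->
  mu.-integrable `]a, b] (EFin \o derive1 f).
Proof.
move=> cf ab bb' /(_ 1 ltr01)[d d0 acf].
have md : measurable_fun [set: measurableTypeR R] (EFin \o derive1 f).
  by apply/measurable_EFinP; exact: measurable_derive1.
have mnd : measurable_fun [set: measurableTypeR R]
    (fun x => `|derive1 f x|%:E).
  apply/measurable_EFinP; apply: (measurableT_comp (@normr_measurable R setT)).
  exact: measurable_derive1.
pose w := Num.min d (b' - b).
have w0 : 0 < w by rewrite lt_min d0 subr_gt0.
pose N := (Num.truncn ((b - a) / w)).+1.
pose e := (b - a) / N%:R.
have e0 : 0 < e by rewrite divr_gt0// subr_gt0.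
have Ne : N%:R * e = b - a by rewrite mulrC divfK// pnatr_eq0.
have /andP[ed eb] : (e < d) && (e < b' - b).
  by rewrite -lt_min -/w ltr_pdivrMr// mulrC -ltr_pdivrMr// truncnS_gt.
have bound m : (m <= N)%N ->
    (\int[mu]_(x in `]a, (a + m%:R * e)%R]) `|derive1 f x|%:E <= m%:R%:E)%E.
  elim: m => [_|m ih mN].
    by rewrite mul0r addr0 set_itvoc0 integral_set0.
  have mNe : m.+1%:R * e <= N%:R * e by rewrite ler_pM2r ?ler_nat.
  have me0 : 0 <= m%:R * e by rewrite mulr_ge0 ?(ltW e0).
  have mSe : a + m.+1%:R * e = a + m%:R * e + e.
    by rewrite -natr1 mulrDl mul1r addrA.
  rewrite (@itv_ocU a (a + m%:R * e)); [|lra|lra].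
  rewrite ge0_integral_setU//=; last 2 first.
  - exact: measurable_funTS.
  - exact: disj_itv_oc.
  rewrite mSe -natr1 EFinD; apply: leeD; first exact: ih (ltnW mN).
  by apply: (integral_derive1_le1 cf acf) => //; lra.
apply/integrableP; split; first exact: measurable_funTS.
have := bound N (leqnn N); rewrite Ne (_ : a + (b - a) = b); last lra.
by move=> /le_lt_trans; apply; exact: ltry.
Qed.

End Integrability.

(** * Fractional integrals of periodic functions *)

Section FracDiff.
Set Implicit Arguments.
Unset Strict Implicit.
Context {R : realType}.
Implicit Types (f : R -> R) (x h : R).
Local Notation mu := (@lebesgue_measure R).

(** Composition with the absolute value extends a function on [0, +oo[ to a
    continuous function on the line without changing its derivative on
    ]0, +oo[. *)
Lemma continuous_comp_norm f : {within `[0, +oo[, continuous f} ->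
  continuous (fun x : R => f `|x|).
Proof.
move=> /continuous_within_itvcyP[cf f0] x.
have [->|x0] := eqVneq x 0.
  apply/cvgrPdist_lt => e e0.
  have /cvgrPdist_lt/(_ _ e0) := f0.
  rewrite /at_right near_withinE => /nbhs_ballP[d /= d0 hd].
  apply/nbhs_ballP; exists d => // y /= yd; have [->|y0] := eqVneq y 0.
    by rewrite !normr0 subrr normr0.
  rewrite normr0; apply: hd; last by rewrite normr_gt0.
  by move: yd; rewrite -!ball_normE /= !sub0r !normrN normr_id.
apply: continuous_comp; first exact: norm_continuous.
by apply: cf; rewrite in_itv /= andbT normr_gt0.
Qed.

Lemma derive1_comp_norm f x : 0 < x ->
  derive1 (fun x : R => f `|x|) x = derive1 f x.
Proof.
move=> x0; rewrite !derive1E; apply: near_eq_derive.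
near=> y; rewrite /= ger0_norm// ltW//.
by near: y; exact: lt_nbhsr.
Unshelve. all: by end_near. Qed.

(** The identity holds at every [x > 0], also where [f] is not derivable: both
    sides are then limits of the same divergent family. *)
Lemma derive1_periodic f (T x : R) : periodic_nneg T f -> 0 < x ->
  derive1 f (x + T) = derive1 f x.
Proof.
move=> fT x0.
rewrite (_ : derive1 f (x + T) = derive1 (fun y => f (y + T)) x); last first.
  rewrite /derive1 (_ : (fun h : R => h^-1 *: (f (h + (x + T)) - f (x + T))) =
    (fun h => h^-1 *: (f (h + x + T) - f (x + T))))//.
  by apply/funext => h; rewrite addrA.
rewrite !derive1E; apply: near_eq_derive.
near=> y; rewrite /= fT// ltW//.
by near: y; exact: lt_nbhsr.
Unshelve. all: by end_near. Qed.

Lemma powR_cvg0 (a : R) : 0 < a -> t `^ (- a) @[t --> +oo] --> (0 : R).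
Proof.
move=> a0; apply/cvgrPdist_le => e e0.
have A0 : 0 < e^-1 `^ a^-1 by rewrite powR_gt0// invr_gt0.
near=> t; have tA : e^-1 `^ a^-1 <= t by near: t; exact: nbhs_pinfty_ge.
have t0 : 0 < t by exact: lt_le_trans tA.
rewrite sub0r normrN ger0_norm ?powR_ge0// powRN invf_ple ?posrE ?powR_gt0//.
rewrite -[leLHS]powRr1 ?invr_ge0 ?(ltW e0)// -(mulVf (lt0r_neq0 a0)) powRrM.
by apply: ge0_ler_powR; rewrite ?nnegrE ?(ltW a0) ?(ltW A0) ?(ltW t0).
Unshelve. all: by end_near. Qed.

Lemma ler_powRN (a x y : R) : 0 <= a -> 0 < x -> x <= y ->
  y `^ (- a) <= x `^ (- a).
Proof.
move=> a0 x0 xy; have y0 := lt_le_trans x0 xy.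
rewrite !powRN lef_pV2 ?posrE ?powR_gt0//.
by apply: ge0_ler_powR; rewrite ?nnegrE ?(ltW x0) ?(ltW y0).
Qed.

(** If [y] is infinite then so is [x + y], and [fine] sends both to 0.  This is
    what lets a divergent fractional integral be treated together with a
    convergent one. *)
Lemma fineB_le (x y : \bar R) : x \is a fin_num ->
  `|fine (x + y)%E - fine y| <= `|fine x|.
Proof.
case: x => [x _| |]//; case: y => [y| |] /=.
- by rewrite addrK.
- by rewrite subr0 normr0.
- by rewrite subr0 normr0.
Qed.

(** The integrals are extended reals: [t] may be a point where the last one
    diverges. *)
Lemma frac_kernel_split (a T t : R) (g : R -> R) : 0 < T -> 0 < t ->
  measurable_fun (`]0, +oo[ : set (measurableTypeR R)) g ->
  (forall s, 0 < s -> g (s + T) = g s) ->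
  (\int[mu]_(s in `]0%R, (t + T)%R[) ((t + T - s) `^ (- a) * g s)%:E =
   \int[mu]_(s in `]0%R, T]) ((t + T - s) `^ (- a) * g s)%:E +
   \int[mu]_(s in `]0%R, t[) ((t - s) `^ (- a) * g s)%:E)%E.
Proof.
move=> T0 t0 mg gT.
pose k (s : R) : \bar R := ((t + T - s) `^ (- a) * g s)%:E.
have mk (D : set (measurableTypeR R)) : D `<=` `]0, +oo[ ->
    measurable_fun D k.
  move=> D0; apply/measurable_EFinP; apply: measurable_funM; last first.
    exact: measurable_funS mg.
  apply: measurable_funTS.
  apply: (measurableT_comp (measurable_powR _)).
  exact: measurable_funB.
have splitT : `]0, (t + T)[%classic = `]0, T] `|` `]T, (t + T)[ :> set R.
  apply/seteqP; split=> s /=; rewrite !in_itv /=.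
    by case: (leP s T) => sT /andP[? ?]; [left|right]; apply/andP; split.
  by case=> /andP[? ?]; lra.
have kT : (\int[mu]_(s in `]T, (t + T)%R[) k s =
    \int[mu]_(s in `]0%R, t[) ((t - s) `^ (- a) * g s)%:E)%E.
  rewrite (integral_shift T); [|exact: measurable_itv|]; last first.
    apply: mk => s /=; rewrite !in_itv /= andbT => /andP[Ts _].
    exact: (lt_trans T0 Ts).
  rewrite preimage_shift_itv subrr addrK; apply: eq_integral => s.
  rewrite inE /= in_itv /= => /andP[s0 _].
  by rewrite /k gT// opprD addrACA subrr addr0.
rewrite -kT splitT; apply: integral_setU; [exact: measurable_itv..| |].
  rewrite -splitT; apply: mk => s /=; rewrite !in_itv /= andbT.
  by case/andP.
exact: disj_itv_oc.
Qed.

(** On ]0, T] the kernel [(t + T - s) `^ (- a)] stays at distance at least [t]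
    from its singularity, hence is at most [t `^ (- a)]. *)
Lemma frac_kernel_head (a T t : R) (g : R -> R) :
  0 <= a -> 0 < t -> mu.-integrable `]0, T] (EFin \o g) ->
  let k s := (t + T - s) `^ (- a) * g s in
  mu.-integrable `]0, T] (EFin \o k) /\
  `|\int[mu]_(s in `]0, T]) k s| <= t `^ (- a) * \int[mu]_(s in `]0, T]) `|g s|.
Proof.
move=> a0 t0 ig k.
have mI : measurable (`]0, T] : set (measurableTypeR R)).
  exact: measurable_itv.
have mg : measurable_fun (`]0, T] : set (measurableTypeR R)) g.
  by apply/measurable_EFinP; apply: (measurable_int _ ig).
have ing : mu.-integrable `]0, T] (EFin \o (fun s => `|g s|)).
  exact: (integrable_norm ig).
have iZg : mu.-integrable `]0, T] (EFin \o (fun s => t `^ (- a) * `|g s|)).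
  by apply: (integrableZl _ (t `^ (- a)) ing).
have kg s : `]0, T]%classic s -> `|k s| <= t `^ (- a) * `|g s|.
  rewrite /= in_itv /= => /andP[s0 sT].
  rewrite normrM ler_wpM2r// ger0_norm ?powR_ge0// ler_powRN//; lra.
have ik : mu.-integrable `]0, T] (EFin \o k).
  apply: (le_integrable mI _ _ iZg).
    apply/measurable_EFinP; apply: measurable_funM; last exact: mg.
    apply: measurable_funTS; apply: (measurableT_comp (measurable_powR _)).
    exact: measurable_funB.
  move=> s sT; rewrite lee_fin; apply: (le_trans (kg s sT)).
  exact: ler_norm.
split; first exact: ik.
rewrite -(RintegralZl _ mI ing).
apply: (le_trans (le_normr_Rintegral mI ik)).
apply: le_Rintegral; [exact: mI| |exact: iZg|exact: kg].
exact: (integrable_norm ik).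
Qed.

Lemma frac_kernel_shift (a T t : R) (g : R -> R) :
  0 <= a -> 0 < T -> 0 < t ->
  measurable_fun (`]0, +oo[ : set (measurableTypeR R)) g ->
  (forall s, 0 < s -> g (s + T) = g s) ->
  mu.-integrable `]0, T] (EFin \o g) ->
  `|\int[mu]_(s in `]0, (t + T)[) ((t + T - s) `^ (- a) * g s) -
    \int[mu]_(s in `]0, t[) ((t - s) `^ (- a) * g s)|
  <= t `^ (- a) * \int[mu]_(s in `]0, T]) `|g s|.
Proof.
move=> a0 T0 t0 mg gT ig; have [ik k_le] := frac_kernel_head a0 t0 ig.
rewrite {1}/Rintegral (frac_kernel_split a T0 t0 mg gT).
apply: le_trans k_le; apply: fineB_le.
by apply: (integrable_fin_num _ ik).
Qed.

End FracDiff.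

(** * The Caputo derivative of a periodic function *)

Section Caputo.
Set Implicit Arguments.
Unset Strict Implicit.
Context {R : realType}.
Local Notation mu := (@lebesgue_measure R).

Lemma measurable_derive1_nneg (f : R -> R) :
  {within `[0, +oo[, continuous f} ->
  measurable_fun (`]0, +oo[ : set (measurableTypeR R)) (derive1 f).
Proof.
move=> cf; have := measurable_derive1 (continuous_comp_norm cf).
move/(@measurable_funTS _ _ _ _ (`]0, +oo[ : set (measurableTypeR R))).
apply: eq_measurable_fun => x; rewrite inE /= in_itv /= andbT.
exact: derive1_comp_norm.
Qed.

Lemma abs_continuous_comp_norm (f : R -> R) (a b : R) : 0 <= a ->
  abs_continuous a b f -> abs_continuous a b (fun x => f `|x|).
Proof.
move=> a0 ac e e0; have [d d0 acd] := ac e e0; exists d => // n u v uv tr sd.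
rewrite (eq_bigr (fun i => `|f (v i) - f (u i)|)); first exact: acd.
move=> i _; have [au [uvi _]] := uv i.
by rewrite (@ger0_norm _ (u i)) ?(@ger0_norm _ (v i))//; lra.
Qed.

Lemma integrable_derive1_nneg (f : R -> R) (T : R) :
  {within `[0, +oo[, continuous f} -> 0 < T ->
  (forall a b : R, 0 <= a -> a <= b -> abs_continuous a b f) ->
  mu.-integrable `]0, T] (EFin \o derive1 f).
Proof.
move=> cf T0 ac.
have : mu.-integrable `]0, T] (EFin \o derive1 (fun x : R => f `|x|)).
  apply: (@integrable_derive1 _ _ 0 T (T + T)) => //.
  - exact: continuous_comp_norm.
  - by rewrite ltrDl.
  - apply: abs_continuous_comp_norm => //; apply: ac => //.
    by rewrite addr_ge0 ?(ltW T0).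
apply: eq_integrable => // x; rewrite inE /= in_itv /= => /andP[x0 _].
by rewrite /= derive1_comp_norm.
Qed.

Lemma caputo_shift_cvg (f : R -> R) (T alpha : R) :
  {within `[0, +oo[, continuous f} -> 0 < T -> periodic_nneg T f ->
  (forall a b : R, 0 <= a -> a <= b -> abs_continuous a b f) ->
  0 < alpha ->
  caputo alpha f (t + T) - caputo alpha f t @[t --> +oo] --> (0 : R).
Proof.
move=> cf T0 fT ac a0.
pose C := `|(Gamma (1 - alpha))^-1| * \int[mu]_(s in `]0, T]) `|derive1 f s|.
have Ccvg : t `^ (- alpha) * C @[t --> +oo] --> (0 : R).
  by rewrite -[X in _ --> X](mul0r C); apply: cvgMl; exact: powR_cvg0.
apply: norm_cvg0; apply: (squeeze_cvgr _ (cvg_cst 0) Ccvg).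
near=> t; have t0 : 0 < t by near: t; exact: nbhs_pinfty_gt.
rewrite normr_ge0 /= /caputo /frac_integral -mulrBr normrM mulrCA.
rewrite ler_wpM2l//.
have -> : 1 - alpha - 1 = - alpha by lra.
apply: frac_kernel_shift => //; first exact: ltW.
- exact: measurable_derive1_nneg.
- by move=> s s0; exact: derive1_periodic.
- exact: integrable_derive1_nneg.
Unshelve. all: by end_near. Qed.

End Caputo.

Theorem theorem3 (R : realType) (T : R) (f : R -> R) (alpha : R)
    (T_gt0 : 0 < T)
    (f_Cb : bounded_continuous f)
    (f_periodic : periodic_nneg T f)
    (f_ac : forall a b : R, 0 <= a -> a <= b -> abs_continuous a b f)
    (alpha_gt0 : 0 < alpha) (alpha_lt1 : alpha < 1)
    (D_bounded : [bounded caputo alpha f t | t in `]0, +oo[]) :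
  (caputo alpha f (t + T) - caputo alpha f t @[t --> +oo] --> (0 : R)) /\
  (forall phi : R -> R,
     (forall t : R, 0 < t -> phi t = caputo alpha f t) ->
     {within `[0, +oo[, continuous phi} ->
     S_asymptotically_periodic T phi).
Proof.
have D_cvg := caputo_shift_cvg f_Cb.1 T_gt0 f_periodic f_ac alpha_gt0.
split=> // phi phiE phi_cont; split; last first.
  apply: cvg_trans D_cvg; apply: near_eq_cvg; near=> t.
  have t_gt0 : 0 < t by near: t; exact: nbhs_pinfty_gt.
  by rewrite !phiE// addr_gt0.
split=> //; have [M [M_real hM]] := D_bounded.
(* At [t = 0] nothing relates [phi] to the Caputo derivative. *)
exists (Num.max M `|phi 0|); split=> [|N]; first exact: num_real.
rewrite gt_max => /andP[MN phi0N] t /=.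
rewrite in_itv /= andbT le_eqVlt => /predU1P[<-|t_gt0]; first exact: ltW.
by rewrite phiE//; apply: (hM N MN); rewrite /= in_itv /= andbT.
Unshelve. all: by end_near. Qed.
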